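(* MEFE-Matching can be solved in polynomial time on instances satisfying all of the following: every course has at most two distinct positive valuations (i.e., for each course $x_i$ there are positive integers $q_i,q_i'$ with $v_i\colon T\to\{0,q_i,q_i'\}$); for each course, no two TAs have the same grade in it (i.e., $g_t(x)\ne g_{t'}(x)$ for all courses $x$ and distinct TAs $t,t'$); and each TA has distinct valuations for its positively valued courses (i.e., $u_t(x)\neq u_t(y)$ for every TA $t$ and distinct courses $x,y$ with $u_t(x),u_t(y)>0$). That is, there is a polynomial-time algorithm that, given such an instance, outputs a MEFE matching if one exists and correctly reports that none exists otherwise.
   Context: An instance of MEFE-Matching consists of: a finite set of courses $X=\{x_1,\dots,x_n\}$; a finite set of TAs $T=\{t_1,\dots,t_m\}$; for each TA $t_i$ a utility (valuation) function $u_i=u_{t_i}\colon X\to\mathbb{Z}_{\ge 0}$ and a grade function $g_i=g_{t_i}\colon X\to\mathbb{Q}_{\ge 0}$; for each course $x_i$ a capacity $c_i$ (a positive integer) and a utility (valuation) function $v_i=v_{x_i}\colon T\to\mathbb{Z}_{\ge 0}$, where for every TA $t$ and course $x_i$ one has $v_i(t)=0$ if $u_t(x_i)=0$ and $v_i(t)>0$ otherwise; and a number $k\in\mathbb{Q}_{\ge 0}$. All numbers are encoded in binary. A matching is a function $\mu\colon T\to X\cup\{\emptyset\}$, where $\mu(t)=\emptyset$ means $t$ is unassigned; by convention $u_t(\emptyset)=0$. It is feasible if $|\mu^{-1}(x_i)|=c_i$ for every course $x_i$ and no TA $t$ is assigned to a course $x$ with $u_t(x)=0$. A MEFE (merit-based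 envy-free egalitarian) matching is a feasible matching $\mu$ such that (1) (satisfaction of courses) for every course $x_i$, $\mathrm{AvgUtil}(x_i)=\frac{1}{c_i}\sum_{t\in\mu^{-1}(x_i)}v_i(t)\ge k$; and (2) (merit-based envy-freeness) there are no two TAs $t_i,t_j$ with $\mu(t_j)\in X$, $g_i(\mu(t_j))\ge g_j(\mu(t_j))$ and $u_i(\mu(t_j))>u_i(\mu(t_i))$. *)

(* Defs.v *)
From mathcomp Require Import all_boot all_order all_algebra.

Set Implicit Arguments.
Unset Strict Implicit.
Unset Printing Implicit Defensive.

Import Order.TTheory GRing.Theory Num.Theory.

(** * Random access machines under the logarithmic cost criterion

    The machine has finitely many (as many as the program mentions) unbounded
    arrays of natural numbers; a scalar register is cell 0 of an array.
    Programs are built from the four arithmetic operations and structured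
    control flow.  Every number that is handled, be it a constant, an address,
    an operand or a stored value, is charged its binary length (Aho, Hopcroft
    and Ullman, "The Design and Analysis of Computer Algorithms", 1.3), so that
    polynomial time means the same as on Turing machines. *)

Definition bits (n : nat) : nat := (trunc_log 2 n).+1.

Inductive binop := OpAdd | OpSub | OpMul | OpDiv.

Inductive expr :=
  | Lit of nat
  | Read of nat & expr
  | Bin of binop & expr & expr.

Inductive cmd :=
  | Skip
  | Write of nat & expr & expr
  | Seq of cmd & cmd
  | If of expr & cmd & cmd
  | While of expr & cmd.

(** [s a i] is the content of cell [i] of array [a]. *)
Definition state := nat -> nat -> nat.

Definition update (s : state) (a i w : nat) : state :=
  fun b j => if (b == a) && (j == i) then w else s b j.

(** [OpSub] is truncated, division by 0 yields 0. *)
Definition eval_op (o : binop) (x y : nat) : nat :=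
  match o with
  | OpAdd => x + y
  | OpSub => x - y
  | OpMul => x * y
  | OpDiv => x %/ y
  end.

Fixpoint eval (s : state) (e : expr) : nat :=
  match e with
  | Lit w => w
  | Read a e1 => s a (eval s e1)
  | Bin o e1 e2 => eval_op o (eval s e1) (eval s e2)
  end.

Fixpoint eval_cost (s : state) (e : expr) : nat :=
  match e with
  | Lit w => bits w
  | Read a e1 => eval_cost s e1 + bits (eval s e1) + bits (s a (eval s e1))
  | Bin _ e1 e2 =>
      eval_cost s e1 + eval_cost s e2 + bits (eval s e1) + bits (eval s e2)
  end.

(** [exec c s t s']: started in [s], [c] halts in [s'] after time [t].
    A test succeeds when its value is nonzero. *)
Inductive exec : cmd -> state -> nat -> state -> Prop :=
  | exec_Skip s : exec Skip s 1 s
  | exec_Write a e1 e2 s :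
      exec (Write a e1 e2) s
        (eval_cost s e1 + eval_cost s e2 + bits (eval s e1) + bits (eval s e2))
        (update s a (eval s e1) (eval s e2))
  | exec_Seq c1 c2 s1 t1 s2 t2 s3 :
      exec c1 s1 t1 s2 -> exec c2 s2 t2 s3 ->
      exec (Seq c1 c2) s1 (t1 + t2) s3
  | exec_IfTrue e c1 c2 s t s' :
      eval s e != 0 -> exec c1 s t s' ->
      exec (If e c1 c2) s (eval_cost s e + bits (eval s e) + t) s'
  | exec_IfFalse e c1 c2 s t s' :
      eval s e = 0 -> exec c2 s t s' ->
      exec (If e c1 c2) s (eval_cost s e + bits (eval s e) + t) s'
  | exec_WhileTrue e c s1 t1 s2 t2 s3 :
      eval s1 e != 0 -> exec c s1 t1 s2 -> exec (While e c) s2 t2 s3 ->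
      exec (While e c) s1 (eval_cost s1 e + bits (eval s1 e) + t1 + t2) s3
  | exec_WhileFalse e c s :
      eval s e = 0 ->
      exec (While e c) s (eval_cost s e + bits (eval s e)) s.

Lemma exec_deterministic c s t1 s1 t2 s2 :
  exec c s t1 s1 -> exec c s t2 s2 -> t1 = t2 /\ s1 = s2.
Proof.
move=> H; elim: H t2 s2 => {c s t1 s1};
  intros;
  match goal with
  | H : exec _ _ ?t ?s |- _ = ?t /\ _ = ?s => inversion H; subst
  end => //;
  try match goal with
  | H : is_true (?x != 0), H' : ?x = 0 |- _ => by rewrite H' in H
  end;
  repeat match goal with
  | IH : forall t s, exec ?c ?s0 t s -> _, H : exec ?c ?s0 _ _ |- _ =>
      case: (IH _ _ H) => ? ?; clear IH; subst
  end; by [].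
Qed.

(** Array 0 holds the input and array 1 receives the output, as a length in
    cell 0 followed by that many numbers. *)
Definition load (w : seq nat) : state :=
  fun a i => if a == 0 then nth 0 (size w :: w) i else 0.

Definition output (s : state) : seq nat :=
  mkseq (fun i => s 1 i.+1) (s 1 0).

(** The number of bits of an input word. *)
Definition input_size (w : seq nat) : nat := \sum_(a <- w) bits a.

(** A single program solves the search problem on all the instances
    satisfying [promise], in time polynomial in the length of the input. *)
Definition polytime_solvable (instance : Type) (answer : instance -> Type)
    (encode_in : instance -> seq nat)
    (encode_out : forall I, answer I -> seq nat)
    (promise : instance -> Prop)
    (correct : forall I, answer I -> Prop) : Prop :=
  exists (c : cmd) (p : {poly nat}),
    forall I, promise I ->
      exists t s',
        [/\ exec c (load (encode_in I)) t s',
            t <= (p.[input_size (encode_in I)])%R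
          & exists2 ans : answer I,
              output s' = encode_out I ans & correct I ans].

(** * MEFE-Matching *)

(** The courses are ['I_(ncourses I)] and the TAs are ['I_(ntas I)]. *)
Record mefe_instance := MefeInstance {
  ncourses : nat;
  ntas : nat;
  util : 'I_ntas -> 'I_ncourses -> nat;
  grade : 'I_ntas -> 'I_ncourses -> rat;
  capacity : 'I_ncourses -> nat;
  cutil : 'I_ncourses -> 'I_ntas -> nat;
  threshold : rat;
  grade_ge0 : forall t x, (0 <= grade t x)%R;
  capacity_gt0 : forall x, 0 < capacity x;
  cutil_eq0 : forall x t, util t x = 0 -> cutil x t = 0;
  cutil_gt0 : forall x t, util t x <> 0 -> 0 < cutil x t;
  threshold_ge0 : (0 <= threshold)%R
}.

(** [None] stands for being unassigned. *)
Definition matching (I : mefe_instance) : Type :=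
  {ffun 'I_(ntas I) -> option 'I_(ncourses I)}.

Definition outcome_util (I : mefe_instance) (t : 'I_(ntas I))
    (o : option 'I_(ncourses I)) : nat :=
  if o is Some x then util t x else 0.

Definition feasible (I : mefe_instance) (mu : matching I) : Prop :=
  (forall x, #|[set t | mu t == Some x]| = capacity x)
  /\ ~ (exists t x, mu t = Some x /\ util t x = 0).

Definition avg_util (I : mefe_instance) (mu : matching I)
    (x : 'I_(ncourses I)) : rat :=
  ((capacity x)%:R^-1 * \sum_(t | mu t == Some x) (cutil x t)%:R)%R.

Definition courses_satisfied (I : mefe_instance) (mu : matching I) : Prop :=
  forall x, (threshold I <= avg_util mu x)%R.

Definition merit_envy_free (I : mefe_instance) (mu : matching I) : Prop :=
  ~ exists (ti tj : 'I_(ntas I)) (x : 'I_(ncourses I)),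
      [/\ ti <> tj, mu tj = Some x,
          (grade tj x <= grade ti x)%R
        & outcome_util ti (mu ti) < util ti x].

Definition mefe (I : mefe_instance) (mu : matching I) : Prop :=
  [/\ feasible mu, courses_satisfied mu & merit_envy_free mu].

Definition two_positive_valuations (I : mefe_instance) : Prop :=
  forall x : 'I_(ncourses I), exists q q' : nat,
    [/\ 0 < q, 0 < q' & forall t, cutil x t \in [:: 0; q; q']].

Definition distinct_grades (I : mefe_instance) : Prop :=
  forall (x : 'I_(ncourses I)) (t t' : 'I_(ntas I)),
    t <> t' -> grade t x <> grade t' x.

Definition distinct_valuations (I : mefe_instance) : Prop :=
  forall (t : 'I_(ntas I)) (x y : 'I_(ncourses I)),
    x <> y -> 0 < util t x -> 0 < util t y -> util t x <> util t y.

(** Tables are listed row by row, and a nonnegative rational is given by the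
    numerator and the denominator of its reduced form. *)
Definition encode_instance (I : mefe_instance) : seq nat :=
  let X := enum 'I_(ncourses I) in
  let T := enum 'I_(ntas I) in
  [:: ncourses I; ntas I]
  ++ [seq util t x | t <- T, x <- X]
  ++ [seq `|numq (grade t x)|%N | t <- T, x <- X]
  ++ [seq `|denq (grade t x)|%N | t <- T, x <- X]
  ++ [seq capacity x | x <- X]
  ++ [seq cutil x t | x <- X, t <- T]
  ++ [:: `|numq (threshold I)|%N; `|denq (threshold I)|%N].

(** The report [None] that no MEFE matching exists is the word [0]; a matching
    is the word 1 followed by, for each TA, 0 if it is unassigned and otherwise
    1 plus the index of its course. *)
Definition encode_answer (I : mefe_instance) (ans : option (matching I)) :
    seq nat :=
  if ans is Some mu then
    1 :: [seq (if mu t is Some x then x.+1 else 0) | t <- enum 'I_(ntas I)]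
  else [:: 0].

Definition correct_answer (I : mefe_instance) (ans : option (matching I)) :
    Prop :=
  if ans is Some mu then mefe mu else ~ exists mu : matching I, mefe mu.

(* Main.v *)
Require Import Defs.
From mathcomp Require Import all_boot all_order all_algebra.
From mathcomp Require Import zify.

Set Implicit Arguments.
Unset Strict Implicit.
Unset Printing Implicit Defensive.

Import Order.TTheory GRing.Theory Num.Theory.

(** Delete, one after the other, pairs (TA, course) that occur in no MEFE
    matching.  If every course that [t'] prefers to [x] is already deleted for
    [t'], then [t'] gets at best [x]; hence a MEFE matching that assigns to [x]
    some [t] with a grade at most that of [t'] has to assign [t'] to [x] as well,
    or [t'] would envy [t].  So [(t, x)] can be deleted as soon as these rivals
    of [t] cannot all be assigned to [x]: one of them is deleted at [x], they
    exceed the capacity, or they fill [x] exactly and leave it unsatisfied.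

    When no further deletion is possible, let every TA point to its best
    remaining course.  The TAs pointing to [x] are the rivals of the worst of
    them, hence fit into [x] and satisfy [x] if they fill it.  If they fill every
    course, pointing is a MEFE matching.  Every TA assigned by a MEFE matching
    points somewhere, so otherwise counting shows that there is none.

    Each of [m * n] sweeps over the [m * n] pairs deletes a new pair or is the
    last one needed. *)

(** * Deletion of pairs *)

Section Deletion.

Variable I : mefe_instance.
Hypothesis Hdv : distinct_valuations I.
Local Notation X := 'I_(ncourses I).
Local Notation T := 'I_(ntas I).
Implicit Types (D : {set T * X}) (t : T) (x : X) (mu : matching I).

(** The TA [t] can hope for nothing better than [x]. Whether [(t, x)] is itself in [D] is left open,
    so that [deletable] can look for rivals deleted at [x]. *)
Definition candidate D t x : bool :=
  (0 < util t x) && [forall y, (util t x < util t y) ==> ((t, y) \in D)].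

Definition rivals D t x : {set T} :=
  [set t' | candidate D t' x && (grade t x <= grade t' x)%R].

(** The condition on the average with denominators cleared, as the machine evaluates it on natural
    numbers. *)
Definition satisfies x (A : {set T}) : bool :=
  `|numq (threshold I)| * capacity x
    <= `|denq (threshold I)| * \sum_(t in A) cutil x t.

Definition deletable D t x : bool :=
  [|| [exists t' in rivals D t x, (t', x) \in D],
      capacity x < #|rivals D t x|
    | (#|rivals D t x| == capacity x) && ~~ satisfies x (rivals D t x)].

Definition step D (p : T * X) : {set T * X} :=
  if deletable D p.1 p.2 then p |: D else D.

Definition sound D := forall mu t x, mefe mu -> mu t = Some x -> (t, x) \notin D.

Definition stationary D := forall t x, deletable D t x -> (t, x) \in D.

(** The TAs whose best remaining course is [x]. *)
Definition pointers D x : {set T} := [set t | candidate D t x & (t, x) \notin D].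

Lemma absq_ge0 (a : rat) : (0 <= a)%R -> (`|numq a|%N%:R / `|denq a|%N%:R)%R = a.
Proof.
by move=> a0; rewrite !natr_absz !ger0_norm ?denq_ge0 ?numq_ge0 // divq_num_den.
Qed.

Lemma leq_cross_rat (a b : rat) : (0 <= a)%R -> (0 <= b)%R ->
  (`|numq a| * `|denq b| <= `|numq b| * `|denq a|)%N = (a <= b)%R.
Proof.
move=> a0 b0; rewrite -[in RHS](absq_ge0 a0) -[in RHS](absq_ge0 b0).
have da : (0 < `|denq a|%N%:R :> rat)%R by rewrite ltr0n absz_gt0 denq_neq0.
have db : (0 < `|denq b|%N%:R :> rat)%R by rewrite ltr0n absz_gt0 denq_neq0.
by rewrite ler_pdivrMr // mulrAC ler_pdivlMr // -!natrM ler_nat.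
Qed.

Lemma satisfiesP mu x :
  (threshold I <= avg_util mu x)%R = satisfies x [set t | mu t == Some x].
Proof.
rewrite /avg_util /satisfies -{1}(absq_ge0 (threshold_ge0 I)).
have dk : (0 < `|denq (threshold I)|%N%:R :> rat)%R.
  by rewrite ltr0n absz_gt0 denq_neq0.
have cx : (0 < (capacity x)%:R :> rat)%R by rewrite ltr0n capacity_gt0.
rewrite ler_pdivrMr // [(_^-1 * _)%R]mulrC mulrAC ler_pdivlMr //.
rewrite -natr_sum -!natrM ler_nat [leqRHS]mulnC.
by under [in RHS]eq_bigl do rewrite inE.
Qed.

(** A course [mu t] other than [x] has positive utility by feasibility. Were it better than [x], its
    pair would be in [D], against soundness; a tie is excluded by distinct valuations. *)
Lemma sound_util_le D mu t x : sound D -> mefe mu -> candidate D t x ->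
  mu t <> Some x -> outcome_util t (mu t) < util t x.
Proof.
move=> sD mmu /andP[u0 /forallP cx].
case E: (mu t) => [y|] //= neq.
have xy : y <> x by move=> e; apply: neq; rewrite e.
have [[_ nu] _ _] := mmu.
have uy : 0 < util t y.
  by rewrite lt0n; apply/eqP => uy; apply: nu; exists t, y.
have := sD _ _ _ mmu E; have := cx y; case: (ltngtP (util t y) (util t x)) => //=.
  by move=> _ -> .
by move=> e; case: (Hdv xy uy u0).
Qed.

Lemma sound_step D p : sound D -> sound (step D p).
Proof.
case: p => t x sD; rewrite /step /=; case: ifPn => // del mu t0 x0 mmu mut0.
rewrite in_setU1 negb_or (sD _ _ _ mmu mut0) andbT; apply/eqP => -[? ?]; subst t0 x0.
have [[card _] sat nenvy] := mmu.
(* A rival placed elsewhere would envy [t], so [mu] assigns all rivals to [x]. Each reason for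
   deletion contradicts this. *)
have sub : rivals D t x \subset [set t' | mu t' == Some x].
  apply/subsetP => t'; rewrite !inE => /andP[ct' gt'].
  apply/eqP/eqP; case: eqP => // neq; case: nenvy.
  exists t', t, x; split=> //; first by move=> e; rewrite e in neq.
  exact: (sound_util_le sD mmu ct').
have /or3P[] := del.
- case/exists_inP => t' /(subsetP sub); rewrite inE => /eqP mut' inD.
  by have := sD _ _ _ mmu mut'; rewrite inD.
- by rewrite ltnNge -card (subset_leq_card sub).
(* The rivals already fill [x], so they are exactly the TAs assigned to it. *)
case/andP=> /eqP eqc; have /eqP -> : rivals D t x == [set t' | mu t' == Some x].
  by rewrite eqEcard sub card eqc leqnn.
by rewrite -satisfiesP sat.
Qed.

Lemma pointers_inj D t x y : t \in pointers D x -> t \in pointers D y -> x = y.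
Proof.
rewrite !inE => /andP[/andP[ux /forallP cx] nx] /andP[/andP[uy /forallP cy] ny].
apply/eqP/idPn => /eqP neq.
case: (ltngtP (util t x) (util t y)) => c.
- by have := cx y; rewrite c (negPf ny).
- by have := cy x; rewrite c (negPf nx).
- by case: (Hdv neq ux uy).
Qed.

(** Take [y] of maximal utility among the courses not deleted for [t]. *)
Lemma pointer_exists D t x : 0 < util t x -> (t, x) \notin D ->
  exists2 y, t \in pointers D y & util t x <= util t y.
Proof.
move=> ux nx; case: (@arg_maxnP _ x (fun y => (t, y) \notin D) (util t)) => // y ny ymax.
exists y; last exact: ymax.
rewrite inE ny andbT /candidate (leq_trans ux (ymax _ nx)) /=.
apply/forallP => z; apply/implyP; apply: contraLR => nz.
by rewrite -leqNgt; apply: ymax.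
Qed.

(** * Matchings from stationary sets of pairs *)

Section Stationary.

Variable D : {set T * X}.
Hypothesis statD : stationary D.

(** Let [t] be the pointer with the lowest grade in [x], so that all pointers are its rivals.
    Conversely, [(t, x)] is not deleted, so by stationarity no rival of [t] is deleted at [x], and
    every rival points to [x]. *)
Lemma rivals_pointers x : pointers D x != set0 ->
  exists2 t, t \in pointers D x & rivals D t x = pointers D x.
Proof.
case/set0Pn => t1 t1P.
case: (@Order.TotalTheory.arg_minP _ _ _ t1 (fun t => t \in pointers D x)
  (fun t => grade t x)) => // t tP tmin.
exists t => //; apply/setP => t'; apply/idP/idP => H'.
  have := H'; rewrite !inE => /andP[-> _] /=.
  move: tP; rewrite inE => /andP[_]; apply: contra => inD.
  by apply: statD; apply/orP; left; apply/exists_inP; exists t'.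
rewrite inE tmin // andbT.
by move: H'; rewrite inE => /andP[].
Qed.

Lemma card_pointers_le x : #|pointers D x| <= capacity x.
Proof.
have [->|] := eqVneq (pointers D x) set0; first by rewrite cards0.
case/rivals_pointers => t tP <-; rewrite leqNgt; apply/negP => lt.
move: tP; rewrite inE => /andP[_ /negP]; apply; apply: statD.
by rewrite /deletable lt orbT.
Qed.

Lemma pointers_satisfies x : #|pointers D x| = capacity x ->
  satisfies x (pointers D x).
Proof.
move=> cx; have : pointers D x != set0 by rewrite -card_gt0 cx capacity_gt0.
case/rivals_pointers => t tP eqR; apply/idPn => ns.
move: tP; rewrite inE => /andP[_ /negP]; apply; apply: statD.
by rewrite /deletable eqR cx eqxx ns !orbT.
Qed.

Definition pointer_matching : matching I :=
  [ffun t => [pick x | t \in pointers D x]].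

Lemma pointer_matchingP t x :
  (pointer_matching t == Some x) = (t \in pointers D x).
Proof.
rewrite ffunE; case: pickP => [y yP|nP]; last by rewrite nP.
by apply/eqP/idP => [[<-]//|xP]; rewrite (pointers_inj yP xP).
Qed.

Lemma mefe_pointer_matching :
  (forall x, #|pointers D x| = capacity x) -> mefe pointer_matching.
Proof.
move=> cP; have preim x : [set t | pointer_matching t == Some x] = pointers D x.
  by apply/setP => t; rewrite inE pointer_matchingP.
split.
- split=> [x|[t [x [/eqP]]]]; first by rewrite preim.
  by rewrite pointer_matchingP inE => /andP[/andP[]]; case: (util t x).
- by move=> x; rewrite satisfiesP preim pointers_satisfies.
case=> ti [tj [x [_ /eqP]]]; rewrite pointer_matchingP => tjP gji ulow.
(* A remaining course at least as good as [x] would make [ti] point to, and hence get, a course at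
   least as good as [x]. *)
have above y : util ti x <= util ti y -> (ti, y) \in D.
  move=> xy; apply/idPn => ny.
  have [|z zP yz] := pointer_exists _ ny; first exact: leq_trans (leq_ltn_trans _ ulow) xy.
  move: zP; rewrite -pointer_matchingP => /eqP e; move: ulow.
  by rewrite e /= ltnNge (leq_trans xy yz).
(* So the envious [ti] is a rival of [tj] that is deleted at [x]. Stationarity then deletes
   [(tj, x)], although [tj] points to [x]. *)
move: tjP; rewrite inE => /andP[_ /negP]; apply; apply: statD.
apply/orP; left; apply/exists_inP; exists ti; last exact: above.
rewrite inE gji andbT /candidate (leq_ltn_trans _ ulow) //=.
by apply/forallP => y; apply/implyP => /ltnW /above.
Qed.

(** Every TA assigned by [mu] points somewhere, so there are at least as many pointers in total as
    places. No course has more pointers than places, so equality holds at each course. *)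
Lemma mefe_pointers_full mu x :
  sound D -> mefe mu -> #|pointers D x| = capacity x.
Proof.
move=> sD mmu; have [[card nu] _ _] := mmu.
have cardE (A : {set T}) : #|A| = \sum_t (t \in A).
  by rewrite -sum1_card big_mkcond; apply: eq_bigr => t _; case: (t \in A).
have le : \sum_(y : X) capacity y <= \sum_(y : X) #|pointers D y|.
  have cE y : capacity y = \sum_t (t \in [set t | mu t == Some y]).
    by rewrite -card cardE.
  have -> : \sum_(y : X) capacity y = \sum_(y : X) \sum_t (t \in [set t | mu t == Some y]).
    by apply: eq_bigr => y _.
  have -> : \sum_(y : X) #|pointers D y| = \sum_(y : X) \sum_t (t \in pointers D y).
    by apply: eq_bigr => y _.
  (* Count by TAs: each contributes at most 1 on the left, and then at least 1 on the right. *)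
  rewrite exchange_big [leqRHS]exchange_big leq_sum // => t _.
  case E: (mu t) => [y|]; last by rewrite big1 // => y _; rewrite inE E.
  have uy : 0 < util t y.
    by rewrite lt0n; apply/eqP => uy; apply: nu; exists t, y.
  have [z zP _] := pointer_exists uy (sD _ _ _ mmu E).
  rewrite (bigD1 y) //= big1 => [|w /negPf yw].
    by rewrite addn0 (bigD1 z) //= zP (leq_trans (leq_b1 _)).
  by rewrite inE E; apply/eqP; rewrite eqb0; apply/eqP => -[e]; rewrite e eqxx in yw.
apply/eqP; rewrite eqn_leq card_pointers_le /=.
move: le; rewrite (bigD1 x) //= [leqRHS](bigD1 x) //= => le.
rewrite -(leq_add2r (\sum_(y : X | y != x) capacity y)) (leq_trans le) //.
by rewrite leq_add2l leq_sum // => y _; apply: card_pointers_le.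
Qed.

End Stationary.
End Deletion.

(** * Programs with bounded loops *)

Definition reg (r : nat) : expr := Read r (Lit 0).

(** The loop [PFor i k p] runs [p] with the counter in cell 0 of array [i], which ranges over the
    numbers below the content of the input cell [k]. All programs terminate, which allows a
    functional semantics. *)
Inductive prog :=
  | PSkip
  | PWrite of nat & expr & expr
  | PSeq of prog & prog
  | PIf of expr & prog & prog
  | PFor of nat & nat & prog.

(** The truncated difference tested by a loop is nonzero exactly while the counter is below the
    bound. *)
Fixpoint compile (p : prog) : cmd :=
  match p with
  | PSkip => Skip
  | PWrite a e1 e2 => Write a e1 e2
  | PSeq p1 p2 => Seq (compile p1) (compile p2)
  | PIf e p1 p2 => If e (compile p1) (compile p2)
  | PFor i k p =>
      Seq (Write i (Lit 0) (Lit 0))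
        (While (Bin OpSub (Read 0 (Lit k)) (reg i))
          (Seq (compile p) (Write i (Lit 0) (Bin OpAdd (reg i) (Lit 1)))))
  end.

Fixpoint den (p : prog) (s : state) : state :=
  match p with
  | PSkip => s
  | PWrite a e1 e2 => update s a (eval s e1) (eval s e2)
  | PSeq p1 p2 => den p2 (den p1 s)
  | PIf e p1 p2 => if eval s e != 0 then den p1 s else den p2 s
  | PFor i k p =>
      iter (s 0 k) (fun st => let st' := den p st in update st' i 0 (st' i 0 + 1))
        (update s i 0 0)
  end.

Fixpoint writes (p : prog) : seq nat :=
  match p with
  | PSkip => [::]
  | PWrite a _ _ => [:: a]
  | PSeq p1 p2 => writes p1 ++ writes p2
  | PIf _ p1 p2 => writes p1 ++ writes p2
  | PFor i _ p => i :: writes p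
  end.

Fixpoint bounds (p : prog) : seq nat :=
  match p with
  | PSkip | PWrite _ _ _ => [::]
  | PSeq p1 p2 => bounds p1 ++ bounds p2
  | PIf _ p1 p2 => bounds p1 ++ bounds p2
  | PFor _ k p => k :: bounds p
  end.

(** A tame expression has only a constant number of bits more than the stored
    numbers, so storing it cannot lead to repeated squaring.  A product may
    still occur in an address or be subtracted. *)
Fixpoint tame (e : expr) : bool :=
  match e with
  | Lit _ | Read _ _ => true
  | Bin OpAdd e1 e2 => tame e1 && tame e2
  | Bin OpSub e1 _ | Bin OpDiv e1 _ => tame e1
  | Bin OpMul _ _ => false
  end.

(** The input array, and with it every loop bound, stays constant, and a loop body does not disturb
    its own counter. *)
Fixpoint wf (p : prog) : bool :=
  match p with
  | PSkip => true
  | PWrite a _ e => (a != 0) && tame e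
  | PSeq p1 p2 => wf p1 && wf p2
  | PIf _ p1 p2 => wf p1 && wf p2
  | PFor i _ p => [&& i != 0, i \notin writes p & wf p]
  end.

(** A literal counts with its value, so that the size also bounds the bits of the constants. *)
Fixpoint esize (e : expr) : nat :=
  match e with
  | Lit w => w.+1
  | Read _ e => (esize e).+1
  | Bin _ e1 e2 => (esize e1 + esize e2).+1
  end.

Lemma den_frame p s b : b \notin writes p -> den p s b =1 s b.
Proof.
elim: p s => [|a e1 e2|p1 IH1 p2 IH2|e p1 IH1 p2 IH2|i k p IH] s //=.
- by rewrite inE => /negPf ba j; rewrite /update ba.
- by rewrite mem_cat negb_or => /andP[b1 b2] j; rewrite IH2 // IH1.
- by rewrite mem_cat negb_or => /andP[b1 b2] j; case: ifP => _; rewrite ?IH1 ?IH2.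
- rewrite inE negb_or => /andP[/negPf bi bp] j.
  elim: (s 0 k) => [|n IHn] /=; first by rewrite /update bi.
  by rewrite {1}/update bi /= IH.
Qed.

Lemma wf_writes p : wf p -> 0 \notin writes p.
Proof.
elim: p => [|a e1 e2|p1 IH1 p2 IH2|e p1 IH1 p2 IH2|i k p IH] //=.
- by case/andP; rewrite inE eq_sym.
- by case/andP => /IH1 h1 /IH2 h2; rewrite mem_cat negb_or h1.
- by case/andP => /IH1 h1 /IH2 h2; rewrite mem_cat negb_or h1.
- by case/and3P => h _ /IH h'; rewrite inE negb_or eq_sym h.
Qed.

(** The invariant rule for loops. The index is an ordinal since it will denote a course or a TA. *)
Lemma den_forP (N : nat) (Inv : nat -> state -> Prop) i k p (s : state) :
  s 0 k = N -> i != 0 -> i \notin writes p -> 0 \notin writes p ->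
  Inv 0 (update s i 0 0) ->
  (forall (j : 'I_N) (st : state), st 0 =1 s 0 -> st i 0 = j :> nat -> Inv j st ->
     Inv j.+1 (update (den p st) i 0 j.+1)) ->
  Inv N (den (PFor i k p) s).
Proof.
move=> sk i0 ip p0 Inv0 IS /=; rewrite sk.
pose F st := let st' := den p st in update st' i 0 (st' i 0 + 1).
suff H j : j <= N -> let st := iter j F (update s i 0 0) in
    [/\ st 0 =1 s 0, st i 0 = j & Inv j st] by have [] := H N (leqnn _).
elim: j => [|j IH] /= jN.
  split=> [b||] //; last by rewrite /update !eqxx.
  by rewrite /update eq_sym (negPf i0).
have [h0 hi hI] := IH (ltnW jN).
set st := iter _ _ _ in h0 hi hI *.
have e : den p st i 0 + 1 = j.+1 by rewrite den_frame // hi addn1.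
rewrite /F e; split=> [b||].
- by rewrite {1}/update eq_sym (negPf i0) /= den_frame.
- by rewrite /update !eqxx.
- exact: (IS (Ordinal jN)).
Qed.

(** The program [pre] runs before each evaluation of [e], which may thus use the result of an inner
    loop. *)
Definition sum_to (r i k : nat) pre e : prog :=
  PSeq (PWrite r (Lit 0) (Lit 0))
    (PFor i k (PSeq pre (PWrite r (Lit 0) (Bin OpAdd (reg r) e)))).

Lemma den_sum_to (N r i k : nat) pre e (s : state) (F : 'I_N -> nat) :
  s 0 k = N -> i != 0 -> r != 0 -> r != i ->
  i \notin writes pre -> r \notin writes pre -> 0 \notin writes pre ->
  (forall (j : 'I_N) (st : state), st i 0 = j :> nat ->
     (forall b, b \notin [:: r, i & writes pre] -> st b =1 s b) ->
     eval (den pre st) e = F j) ->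
  den (sum_to r i k pre e) s r 0 = \sum_j F j.
Proof.
move=> sk i0 r0 ri ip rp p0 HF.
set body := PSeq pre (PWrite r (Lit 0) (Bin OpAdd (reg r) e)).
set s1 := update s r 0 0; rewrite -[den _ _]/(den (PFor i k body) s1).
(* After [l] rounds the accumulator holds the first [l] terms, and all arrays outside the loop's own
   are unchanged. *)
pose Inv (l : nat) (st : state) := st r 0 = \sum_(j < N | j < l) F j /\
  forall b, b \notin [:: r, i & writes pre] -> st b =1 s b.
have fr0 : s1 0 =1 s 0 by move=> b; rewrite /s1 /update eq_sym (negPf r0).
suff [] : Inv N (den (PFor i k body) s1).
  by move=> -> _; apply: eq_bigl => j; rewrite ltn_ord.
apply: den_forP => //.
- by rewrite fr0.
- by rewrite /= mem_cat negb_or ip inE eq_sym ri.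
- by rewrite /= mem_cat negb_or p0 inE eq_sym r0.
- split; first by rewrite {1}/update (negPf ri) /s1 /update !eqxx /= big1.
  move=> b; rewrite !inE !negb_or => /and3P[br bi _] a.
  by rewrite /s1 /update (negPf bi) /= (negPf br).
move=> j st h0 hi [hr fr]; split.
  rewrite {1}/update (negPf ri) /= /update !eqxx /= den_frame // hr (HF j) //.
  rewrite addnC [RHS](bigD1 j) /=; last exact: ltnSn.
  by congr addn; apply: eq_bigl => l; rewrite ltnS [in RHS]andbC -ltn_neqAle.
move=> b; have := fr b; rewrite !inE !negb_or => fb /and3P[br bi bp] a.
by rewrite {1}/update (negPf bi) /= {1}/update (negPf br) /= den_frame ?fb ?br ?bi.
Qed.

(** * Bit lengths and running time *)

Definition fits (L : nat) (s : state) := forall a i, s a i < 2 ^ L.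

Lemma fits_widen L L' s : L <= L' -> fits L s -> fits L' s.
Proof. by move=> le f a i; apply: leq_trans (f a i) _; rewrite leq_exp2l. Qed.

Lemma fits_update L s a i w : fits L s -> w < 2 ^ L -> fits L (update s a i w).
Proof. by move=> f lt b j; rewrite /update; case: ifP. Qed.

(** An addition gains at most one bit over its longer operand; a difference or quotient never
    exceeds its first operand. *)
Lemma eval_tame L s e : fits L s -> tame e -> eval s e < 2 ^ (L + esize e).
Proof.
move=> f; elim: e => [w|a e IH|o e1 IH1 e2 IH2] /=.
- by move=> _; rewrite (leq_trans (ltn_expl w (ltnSn 1))) // leq_exp2l //; lia.
- by move=> _; apply: leq_trans (f _ _) _; rewrite leq_exp2l // leq_addr.
have mono z : z < 2 ^ (L + esize e1) -> z < 2 ^ (L + (esize e1 + esize e2).+1).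
  by move/leq_trans; apply; rewrite leq_exp2l //; lia.
case: o => //=.
- case/andP => /IH1 h1 /IH2 h2.
  have : 2 ^ (L + esize e1) + 2 ^ (L + esize e2) <= 2 ^ (L + (esize e1 + esize e2).+1).
    rewrite addnS expnS mul2n -addnn leq_add // leq_exp2l //; lia.
  lia.
- by move=> /IH1 h1; apply: mono; apply: leq_ltn_trans (leq_subr _ _) h1.
- by move=> /IH1 h1; apply: mono; apply: leq_ltn_trans (leq_div _ _) h1.
Qed.

Lemma esize_gt0 e : 0 < esize e. Proof. by case: e. Qed.

(** Products add up the lengths of their factors, so here the length is multiplied by the size. This
    serves to bound costs, not the growth of stored numbers. *)
Lemma eval_lt L s e : fits L s -> eval s e < 2 ^ (L.+1 * esize e).
Proof.
move=> f; elim: e => [w|a e IH|o e1 IH1 e2 IH2] /=.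
- by rewrite (leq_trans (ltn_expl w (ltnSn 1))) // leq_exp2l //; nia.
- by apply: leq_trans (f _ _) _; rewrite leq_exp2l //; nia.
set x := eval s e1 in IH1 *; set y := eval s e2 in IH2 *.
have mx := esize_gt0 e1; have my := esize_gt0 e2.
have B : 2 ^ (L.+1 * esize e1) * 2 ^ (L.+1 * esize e2) * 2
    <= 2 ^ (L.+1 * (esize e1 + esize e2).+1).
  by rewrite -expnD -[X in _ * X]expn1 -expnD leq_exp2l //; nia.
set P := 2 ^ _ in IH1 B; set Q := 2 ^ _ in IH2 B.
have p0 : 0 < P by rewrite expn_gt0.
have q0 : 0 < Q by rewrite expn_gt0.
case: o => /=; apply: leq_trans B.
- nia.
- nia.
- nia.
- by have := leq_div x y; nia.
Qed.

Lemma bits_le K v : 0 < K -> v < 2 ^ K -> bits v <= K.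
Proof.
move=> k0 lt; rewrite /bits; case: v lt => [|v] lt; first by rewrite trunc_log0.
by rewrite -(ltn_exp2l _ _ (ltnSn 1)) (leq_ltn_trans _ lt) // trunc_logP.
Qed.

Lemma bits_eval L s e : fits L s -> bits (eval s e) <= L.+1 * esize e.
Proof. by move=> f; apply: bits_le (eval_lt _ f); rewrite muln_gt0 esize_gt0. Qed.

Lemma eval_cost_le L s e : fits L s -> eval_cost s e <= 2 * L.+1 * esize e ^ 2.
Proof.
move=> f; elim: e => [w|a e IH|o e1 IH1 e2 IH2] /=.
- have : bits w <= w.+1.
    by apply: bits_le => //; apply: leq_trans (ltn_expl w (ltnSn 1)) _; rewrite leq_exp2l.
  by nia.
- have := bits_eval e f; have : bits (s a (eval s e)) <= L.+1.
    by apply: bits_le => //; apply: leq_trans (f _ _) _; rewrite leq_exp2l.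
  by nia.
- by have := bits_eval e1 f; have := bits_eval e2 f; nia.
Qed.

Definition step_cost (L : nat) (e : expr) : nat := 2 * L.+1 * esize e ^ 2 + L.+1 * esize e.

Arguments step_cost : simpl never.

Lemma step_cost_le L s e : fits L s -> eval_cost s e + bits (eval s e) <= step_cost L e.
Proof. by move=> f; rewrite leq_add ?eval_cost_le ?bits_eval. Qed.

Definition test k i := Bin OpSub (Read 0 (Lit k)) (reg i).
Definition succ i := Bin OpAdd (reg i) (Lit 1).
Arguments test : simpl never.
Arguments succ : simpl never.

(** [N] bounds the number of iterations of every loop. *)
Fixpoint growth (N : nat) (p : prog) : nat :=
  match p with
  | PSkip => 0
  | PWrite _ _ e => esize e
  | PSeq p1 p2 | PIf _ p1 p2 => growth N p1 + growth N p2
  | PFor i _ p => N * (growth N p + esize (succ i))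
  end.

(** A time bound for states with numbers of [L] bits. All iterations of a loop are charged at the
    width [L'] reached at its end; the separate [test] is the failing one. *)
Fixpoint time (N : nat) (p : prog) (L : nat) : nat :=
  match p with
  | PSkip => 1
  | PWrite _ e1 e2 => step_cost L e1 + step_cost L e2
  | PSeq p1 p2 => time N p1 L + time N p2 (L + growth N p1)
  | PIf e p1 p2 => step_cost L e + (time N p1 L + time N p2 L)
  | PFor i k p =>
      let L' := L + growth N (PFor i k p) in
      2 * step_cost L (Lit 0) + step_cost L' (test k i) +
      N * (step_cost L' (test k i) +
           (time N p L' + (step_cost L' (Lit 0) + step_cost L' (succ i))))
  end.

Lemma step_cost_widen L L' e : L <= L' -> step_cost L e <= step_cost L' e.
Proof. by move=> le; rewrite /step_cost leq_add // leq_mul // leq_mul. Qed.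

Lemma time_widen N p L L' : L <= L' -> time N p L <= time N p L'.
Proof.
elim: p L L' => [|a e1 e2|p1 IH1 p2 IH2|e p1 IH1 p2 IH2|i k p IH] L L' le //=.
- by apply: leq_add; apply: step_cost_widen.
- by apply: leq_add; [apply: IH1|apply: IH2; rewrite leq_add2r].
- by apply: leq_add; [apply: step_cost_widen|apply: leq_add; [apply: IH1|apply: IH2]].
have leL : L + N * (growth N p + esize (succ i)) <= L' + N * (growth N p + esize (succ i)).
  by rewrite leq_add2r.
apply: leq_add.
  by apply: leq_add; [apply: leq_mul => //|]; apply: step_cost_widen.
apply: leq_mul => //; apply: leq_add; first exact: step_cost_widen.
apply: leq_add; first exact: IH.
by apply: leq_add; apply: step_cost_widen.
Qed.

Lemma exec_compile N p L s : wf p -> (forall k, k \in bounds p -> s 0 k <= N) -> fits L s ->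
  exists t, [/\ exec (compile p) s t (den p s), t <= time N p L
    & fits (L + growth N p) (den p s)].
Proof.
elim: p L s => [|a e1 e2|p1 IH1 p2 IH2|e p1 IH1 p2 IH2|i k p IH] L s /=.
- by move=> _ _ f; exists 1; split=> //; [exact: exec_Skip|rewrite addn0].
- case/andP=> a0 te _ f; eexists; split; first exact: exec_Write.
    by rewrite -addnA addnACA; apply: leq_add; apply: step_cost_le.
  apply: fits_update; last exact: eval_tame.
  by apply: fits_widen f; apply: leq_addr.
- case/andP=> w1 w2 b f.
  have [|t1 [x1 l1 f1]] := IH1 L s w1 _ f.
    by move=> k kb; apply: b; rewrite mem_cat kb.
  have [|t2 [x2 l2 f2]] := IH2 _ (den p1 s) w2 _ f1.
    by move=> k kb; rewrite den_frame ?wf_writes // b // mem_cat kb orbT.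
  exists (t1 + t2); split; [exact: exec_Seq x1 x2|exact: leq_add|].
  by rewrite addnA.
- case/andP=> w1 w2 b f; case: ifPn => h.
    have [|t1 [x1 l1 f1]] := IH1 L s w1 _ f.
      by move=> k kb; apply: b; rewrite mem_cat kb.
    eexists; split; first exact: exec_IfTrue h x1.
      by apply: leq_add (step_cost_le _ f) _; apply: leq_trans l1 (leq_addr _ _).
    by apply: fits_widen f1; rewrite addnA leq_addr.
  have [|t1 [x1 l1 f1]] := IH2 L s w2 _ f.
    by move=> k kb; apply: b; rewrite mem_cat kb orbT.
  eexists; split; first by apply: exec_IfFalse x1; apply/eqP; rewrite -[_ == _]negbK.
    by apply: leq_add (step_cost_le _ f) _; apply: leq_trans l1 (leq_addl _ _).
  by apply: fits_widen f1; rewrite leq_add2l leq_addl.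
case/and3P=> i0 ip wp b f.
pose F := fun st => let st' := den p st in update st' i 0 (st' i 0 + 1).
(* The 5 is [esize (succ i)], the growth allowed for incrementing the counter. *)
set G := growth N p + 5.
set L' := L + N * G.
set C := step_cost L' (test k i) + (time N p L' + (step_cost L' (Lit 0) + step_cost L' (succ i))).
have bk : s 0 k <= N by apply: b; rewrite mem_head.
have ba k' : k' \in bounds p -> s 0 k' <= N.
  by move=> kb; apply: b; rewrite inE kb orbT.
(* Induction on the number [d] of iterations left, after [j] iterations that have each cost at most
   [G] bits of width. *)
have loop d st j : j + d = s 0 k -> st 0 =1 s 0 -> st i 0 = j -> fits (L + j * G) st ->
  exists t, [/\ exec (While (test k i) (Seq (compile p) (Write i (Lit 0) (succ i))))
      st t (iter d F st),
    t <= step_cost L' (test k i) + d * C & fits (L + (j + d) * G) (iter d F st)].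
  elim: d st j => [|d IHd] st j jd h0 hi fst.
    have fL' : fits L' st by apply: fits_widen fst; rewrite leq_add2l leq_mul2r; lia.
    eexists; split.
    - by apply: exec_WhileFalse; rewrite /= h0 hi; lia.
    - by rewrite mul0n addn0; apply: step_cost_le.
    - by rewrite addn0.
  have fL' : fits L' st by apply: fits_widen fst; rewrite leq_add2l leq_mul2r; lia.
  have [|t1 [x1 l1 f1]] := IH _ st wp _ fst.
    by move=> k' kb; rewrite h0; apply: ba.
  have jN : L + j * G + growth N p + 5 <= L'.
    by rewrite -!addnA -/G -mulSnr leq_add2l leq_mul2r; lia.
  have f1' : fits L' (den p st) by apply: fits_widen f1; lia.
  have f2 : fits (L + j.+1 * G) (F st).
    apply: fits_update.
      by apply: fits_widen f1; rewrite mulSn /G; lia.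
    have := eval_tame (e := succ i) f1 isT; rewrite /= => /leq_trans; apply.
    by rewrite leq_exp2l // mulSn /G; lia.
  have [|b'||t2 [x2 l2 f3]] := IHd (F st) j.+1 _ _ _ f2.
  - by rewrite addSnnS.
  - by rewrite /F {1}/update eq_sym (negPf i0) /= den_frame ?wf_writes.
  - by rewrite /F /update !eqxx den_frame // hi addn1.
  rewrite iterSr; set st1 := den p st in f1' x1 f1 *.
  exists (eval_cost st (test k i) + bits (eval st (test k i)) +
    (t1 + (eval_cost st1 (Lit 0) + eval_cost st1 (succ i) + bits (eval st1 (Lit 0)) +
           bits (eval st1 (succ i)))) + t2); split; last by rewrite addnS -addSn.
    apply: exec_WhileTrue x2; first by rewrite /= h0 hi; lia.
    by apply: exec_Seq x1 _; apply: exec_Write.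
  rewrite mulSn {1}/C.
  have := step_cost_le (test k i) fL'.
  have := step_cost_le (Lit 0) f1'.
  have := step_cost_le (succ i) f1'.
  have l1' : t1 <= time N p L'.
    by apply: leq_trans l1 _; apply: time_widen; lia.
  move: l2 l1'; lia.
have [] := loop (s 0 k) (update s i 0 0) 0.
- by rewrite add0n.
- by move=> b'; rewrite /update eq_sym (negPf i0).
- by rewrite /update !eqxx.
- by rewrite addn0; apply: fits_update => //; rewrite expn_gt0.
move=> t [x l f']; eexists; split.
- by apply: exec_Seq x; apply: exec_Write.
- have := step_cost_le (Lit 0) f => /= h.
  have : s 0 k * C <= N * C by rewrite leq_mul2r bk orbT.
  by rewrite -/G -/L' -/C; move: l h; lia.
- apply: fits_widen f'; rewrite leq_add2l add0n leq_mul2r bk orbT //.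
Qed.

(** * Polynomial bounds *)

Definition polybounded (f : nat -> nat) := exists p : {poly nat}, forall n, f n <= p.[n]%R.

Lemma polybounded_le f g : (forall n, f n <= g n) -> polybounded g -> polybounded f.
Proof. by move=> fg [p gp]; exists p => n; apply: leq_trans (fg n) (gp n). Qed.

Lemma polybounded_const c : polybounded (fun=> c).
Proof. by exists (c%:P)%R => n; rewrite hornerC. Qed.

Lemma polybounded_id : polybounded id.
Proof. by exists 'X%R => n; rewrite hornerX. Qed.

Lemma polyboundedD f g : polybounded f -> polybounded g -> polybounded (fun n => f n + g n).
Proof.
by move=> [p fp] [q gq]; exists (p + q)%R => n; rewrite hornerD; apply: leq_add.
Qed.

Lemma polyboundedM f g : polybounded f -> polybounded g -> polybounded (fun n => f n * g n).
Proof.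
by move=> [p fp] [q gq]; exists (p * q)%R => n; rewrite hornerM; apply: leq_mul.
Qed.

Lemma polybounded_growth p : polybounded (fun N => growth N p).
Proof.
elim: p => [|a e1 e2|p1 IH1 p2 IH2|e p1 IH1 p2 IH2|i k p IH] /=;
  try exact: polybounded_const; try exact: polyboundedD.
apply: polyboundedM; first exact: polybounded_id.
by apply: polyboundedD; last exact: polybounded_const.
Qed.

Lemma polybounded_step_cost f e : polybounded f -> polybounded (fun N => step_cost (f N) e).
Proof.
move=> pf; have pf1 : polybounded (fun N => (f N).+1).
  by apply: polybounded_le (polyboundedD (polybounded_const 1) pf).
apply: polyboundedD; apply: polyboundedM; try exact: polybounded_const.
  by apply: polyboundedM; first exact: polybounded_const.
exact: pf1.
Qed.

(** The width is an arbitrary polynomially bounded [f], because subprograms start with the width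
    their predecessors have produced. *)
Lemma polybounded_time p f : polybounded f -> polybounded (fun N => time N p (f N)).
Proof.
elim: p f => [|a e1 e2|p1 IH1 p2 IH2|e p1 IH1 p2 IH2|i k p IH] f pf /=.
- exact: polybounded_const.
- by apply: polyboundedD; apply: polybounded_step_cost.
- apply: polyboundedD; first exact: IH1.
  by apply: IH2; apply: polyboundedD => //; apply: polybounded_growth.
- apply: polyboundedD; first exact: polybounded_step_cost.
  by apply: polyboundedD; [apply: IH1|apply: IH2].
have pf' := polyboundedD pf (polybounded_growth (PFor i k p)).
have sc e := polybounded_step_cost e pf'.
apply: polyboundedD.
  apply: polyboundedD; last exact: sc.
  by apply: polyboundedM; [exact: polybounded_const|exact: polybounded_step_cost].
apply: polyboundedM; first exact: polybounded_id.
apply: polyboundedD; first exact: sc.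
by apply: polyboundedD; [exact: IH|apply: polyboundedD; exact: sc].
Qed.

Lemma ltn_exp_bits v : v < 2 ^ bits v.
Proof. by rewrite /bits trunc_log_ltn. Qed.

Lemma size_le_input_size w : size w <= input_size w.
Proof. by rewrite /input_size -sum1_size; apply: leq_sum. Qed.

(** Cell 0 holds the length of [w], which is at most [input_size w] since every number is charged at
    least one bit. *)
Lemma fits_load w : fits (input_size w) (load w).
Proof.
move=> a i; rewrite /load; case: ifP => _; last by rewrite expn_gt0.
case: i => [|i] /=.
  by apply: leq_ltn_trans (size_le_input_size w) (ltn_expl _ _).
have [lt|le] := ltnP i (size w); last by rewrite nth_default // expn_gt0.
apply: leq_trans (ltn_exp_bits _) _; rewrite leq_exp2l //.
by rewrite /input_size (big_nth 0) big_mkord (bigD1 (Ordinal lt)) //= leq_addr.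
Qed.

(** * The program and its specification *)

Lemma nth_allpairs (A B C : Type) (a0 : A) (b0 : B) (c0 : C) (f : A -> B -> C)
    (s : seq A) (u : seq B) i j :
  i < size s -> j < size u ->
  nth c0 [seq f a b | a <- s, b <- u] (i * size u + j) = f (nth a0 s i) (nth b0 u j).
Proof.
elim: s i => [|a s IH] [|i] //= lti ltj; rewrite nth_cat size_map.
  by rewrite mul0n add0n ltj (nth_map b0).
by rewrite mulSn -addnA ltnNge leq_addr /= addKn IH.
Qed.

Lemma nth_cat_size (A : Type) (d : A) (s1 s2 : seq A) k i :
  size s1 = k -> nth d (s1 ++ s2) (k + i) = nth d s2 i.
Proof. by move=> <-; rewrite nth_cat ltnNge leq_addr addKn. Qed.

Lemma ltn_row m n (i : 'I_m) (j : 'I_n) : i * n + j < m * n.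
Proof. by apply: leq_trans (leq_mul (ltn_ord i) (leqnn n)); rewrite mulSn addnC ltn_add2r. Qed.

(** Marking one pair as deleted therefore leaves the cells of all other pairs alone. *)
Lemma row_inj m n (i i' : 'I_m) (j j' : 'I_n) :
  i * n + j = i' * n + j' -> i = i' /\ j = j'.
Proof.
move=> e; have n0 : 0 < n by apply: leq_ltn_trans (ltn_ord j).
have := congr1 (divn^~ n) e; rewrite !divnMDl // !divn_small // !addn0 => ei.
by split; apply: val_inj => //=; move: e; rewrite ei => /addnI.
Qed.

Lemma nth_table m n (f : 'I_m -> 'I_n -> nat) (i : 'I_m) (j : 'I_n) s :
  nth 0 ([seq f a b | a <- enum 'I_m, b <- enum 'I_n] ++ s) (i * n + j) = f i j.
Proof.
rewrite nth_cat size_allpairs !size_enum_ord ltn_row.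
have := nth_allpairs i j 0 f (s := enum 'I_m) (u := enum 'I_n) (i := i) (j := j).
by rewrite !size_enum_ord !nth_ord_enum; apply.
Qed.

Section Addresses.

Variable I : mefe_instance.
Local Notation n := (ncourses I).
Local Notation m := (ntas I).
Local Notation input := (load (encode_instance I) 0).
Implicit Types (t : 'I_m) (x : 'I_n).

Let size_table p q (f : 'I_p -> 'I_q -> nat) :
  size [seq f a b | a <- enum 'I_p, b <- enum 'I_q] = p * q.
Proof. by rewrite size_allpairs !size_enum_ord. Qed.

Let size_column p (f : 'I_p -> nat) : size [seq f a | a <- enum 'I_p] = p.
Proof. by rewrite size_map size_enum_ord. Qed.

Lemma input_ncourses : input 1 = n. Proof. by []. Qed.
Lemma input_ntas : input 2 = m. Proof. by []. Qed.

(** The tables start at cell 3, after the length of the word and the two dimensions. *)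
Lemma input_util t x : input (3 + (t * n + x)) = util t x.
Proof. by rewrite /load /encode_instance /= nth_table. Qed.

Lemma input_num t x : input (3 + m * n + (t * n + x)) = `|numq (grade t x)|%N.
Proof.
rewrite /load /encode_instance /= add0n -?addnA.
rewrite nth_cat_size ?size_table ?size_column //.
exact: nth_table.
Qed.

Lemma input_den t x : input (3 + m * n + m * n + (t * n + x)) = `|denq (grade t x)|%N.
Proof.
rewrite /load /encode_instance /= add0n -?addnA.
do 2 rewrite nth_cat_size ?size_table ?size_column //.
exact: nth_table.
Qed.

Lemma input_capacity x : input (3 + m * n + m * n + m * n + x) = capacity x.
Proof.
rewrite /load /encode_instance /= add0n -?addnA.
do 3 rewrite nth_cat_size ?size_table ?size_column //.
by rewrite nth_cat size_map size_enum_ord ltn_ord (nth_map x) ?size_enum_ord ?nth_ord_enum.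
Qed.

Lemma input_cutil x t :
  input (3 + m * n + m * n + m * n + n + (x * m + t)) = cutil x t.
Proof.
rewrite /load /encode_instance /= add0n -?addnA.
do 4 rewrite nth_cat_size ?size_table ?size_column //.
exact: nth_table.
Qed.

Lemma input_threshold_num :
  input (3 + m * n + m * n + m * n + n + n * m) = `|numq (threshold I)|%N.
Proof.
rewrite -[n * m]addn0.
rewrite /load /encode_instance /= add0n -?addnA.
do 5 rewrite nth_cat_size ?size_table ?size_column //.
Qed.

Lemma input_threshold_den :
  input (3 + m * n + m * n + m * n + n + n * m + 1) = `|denq (threshold I)|%N.
Proof.
rewrite /load /encode_instance /= add0n -?addnA.
do 5 rewrite nth_cat_size ?size_table ?size_column //.
Qed.

Lemma size_encode_instance :
  size (encode_instance I) = 4 + 3 * (m * n) + n + n * m.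
Proof.
rewrite /encode_instance !size_cat !size_table size_map size_enum_ord /=; lia.
Qed.

End Addresses.

(** Array 2 holds the set of deleted pairs; 3, 4, 7 and 8 are the registers of
    the courses and TAs [x], [t], [t'] and [y], 5 and 6 count the sweeps, and 9 to
    13 are accumulators.  Truth values are 0 and 1; truncated subtraction keeps
    the connectives and [eif] tame. *)
Definition eadd := Bin OpAdd.
Definition emul := Bin OpMul.
Definition enot b := Bin OpSub (Lit 1) b.
Definition eand b1 b2 := Bin OpSub b1 (enot b2).
Definition ele e1 e2 := enot (Bin OpSub e1 e2).
Definition elt e1 e2 := enot (ele e2 e1).
Definition eeq e1 e2 := eand (ele e1 e2) (ele e2 e1).
Definition eif b e := Bin OpSub e (emul e (enot b)).

Definition encourses := Read 0 (Lit 1).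
Definition entas := Read 0 (Lit 2).
Definition etable_size := emul entas encourses.
Definition eidx e1 w e2 := eadd (emul e1 w) e2.
Definition eutil t x := Read 0 (eadd (Lit 3) (eidx t encourses x)).
Definition egrade_num t x := Read 0 (eadd (eadd (Lit 3) etable_size) (eidx t encourses x)).
Definition egrade_den t x :=
  Read 0 (eadd (eadd (eadd (Lit 3) etable_size) etable_size) (eidx t encourses x)).
Definition ebase := eadd (eadd (eadd (Lit 3) etable_size) etable_size) etable_size.
Definition ecapacity x := Read 0 (eadd ebase x).
Definition ecutil x t := Read 0 (eadd (eadd ebase encourses) (eidx x entas t)).
Definition ethnum_addr := eadd (eadd ebase encourses) (emul encourses entas).
Definition ethnum := Read 0 ethnum_addr.
Definition ethden := Read 0 (eadd ethnum_addr (Lit 1)).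
Definition edeleted t x := Read 2 (eidx t encourses x).

Definition x_ := reg 3.
Definition t_ := reg 4.
Definition t'_ := reg 7.
Definition y_ := reg 8.

(** Counts in register 9 the remaining courses that [t'] prefers to [x]. The quantifier in
    [candidate] holds when the count is 0, so [ecandidate] is meaningful only after this program. *)
Definition better_prog :=
  sum_to 9 8 1 PSkip
    (eand (elt (eutil t'_ x_) (eutil t'_ y_)) (enot (edeleted t'_ y_))).
Definition ecandidate := eand (elt (Lit 0) (eutil t'_ x_)) (enot (reg 9)).
Definition erival :=
  eand ecandidate
    (ele (emul (egrade_num t_ x_) (egrade_den t'_ x_))
       (emul (egrade_num t'_ x_) (egrade_den t_ x_))).
Definition epointer := eand ecandidate (enot (edeleted t'_ x_)).

Definition card_prog := sum_to 10 7 2 better_prog erival.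
Definition total_prog := sum_to 11 7 2 better_prog (eif erival (ecutil x_ t'_)).
Definition conflict_prog := sum_to 12 7 2 better_prog (eand erival (edeleted t'_ x_)).
Definition eoverfull := elt (ecapacity x_) (reg 10).
Definition eunsatisfied :=
  eand (eeq (reg 10) (ecapacity x_))
    (elt (emul ethden (reg 11)) (emul ethnum (ecapacity x_))).
(** A sum serves as disjunction: it is nonzero when one of its terms is. *)
Definition edeletable := eadd (reg 12) (eadd eoverfull eunsatisfied).
Definition step_prog :=
  PSeq card_prog (PSeq total_prog (PSeq conflict_prog
    (PIf edeletable (PWrite 2 (eidx t_ encourses x_) (Lit 1)) PSkip))).
Definition round_prog := PFor 3 1 (PFor 4 2 step_prog).
(** A loop bound has to be an input cell, so the product of the two dimensions takes two nested
    loops. *)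
Definition rounds_prog := PFor 5 1 (PFor 6 2 round_prog).
Definition pointers_prog := sum_to 10 7 2 better_prog epointer.
Definition fail_prog := sum_to 13 3 1 pointers_prog (enot (eeq (reg 10) (ecapacity x_))).
Definition header_prog :=
  PSeq (PWrite 1 (Lit 0) (eadd entas (Lit 1))) (PWrite 1 (Lit 1) (Lit 1)).
(** Cell 0 of the output is its length and cell 1 the tag, so the entry of a TA is shifted by 2.
    Unassigned TAs keep the initial 0. *)
Definition assign_prog :=
  PFor 3 1 (PFor 7 2 (PSeq better_prog
    (PIf epointer (PWrite 1 (eadd t'_ (Lit 2)) (eadd x_ (Lit 1))) PSkip))).
Definition main_prog :=
  PSeq rounds_prog (PSeq fail_prog
    (PIf (reg 13) (PWrite 1 (Lit 0) (Lit 1)) (PSeq header_prog assign_prog))).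

(** * Evaluation of the derived expressions *)

Lemma eval_enot s e (b : bool) : eval s e = b :> nat -> eval s (enot e) = (~~ b) :> nat.
Proof. by move=> /= ->; case: b. Qed.

Lemma eval_eand s e1 e2 (b1 b2 : bool) : eval s e1 = b1 :> nat -> eval s e2 = b2 :> nat ->
  eval s (eand e1 e2) = (b1 && b2) :> nat.
Proof. by move=> /= -> ->; case: b1; case: b2. Qed.

Lemma eval_ele s e1 e2 v1 v2 : eval s e1 = v1 -> eval s e2 = v2 ->
  eval s (ele e1 e2) = (v1 <= v2) :> nat.
Proof. by move=> /= -> ->; lia. Qed.

Lemma eval_elt s e1 e2 v1 v2 : eval s e1 = v1 -> eval s e2 = v2 ->
  eval s (elt e1 e2) = (v1 < v2) :> nat.
Proof. by move=> /= -> ->; lia. Qed.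

Lemma eval_eeq s e1 e2 v1 v2 : eval s e1 = v1 -> eval s e2 = v2 ->
  eval s (eeq e1 e2) = (v1 == v2) :> nat.
Proof. by move=> /= -> ->; lia. Qed.

Lemma eval_eif s b e (c : bool) v : eval s b = c :> nat -> eval s e = v ->
  eval s (eif b e) = if c then v else 0.
Proof. by move=> /= -> ->; case: c => /=; rewrite ?muln0 ?muln1 ?subn0 ?subnn. Qed.

Section Program.

Variable I : mefe_instance.
Hypothesis Hdv : distinct_valuations I.
Local Notation n := (ncourses I).
Local Notation m := (ntas I).
Local Notation T := 'I_m.
Local Notation X := 'I_n.
Local Notation pairs := {set T * X}.
Implicit Types (D : pairs) (t : T) (x : X) (s : state).

Definition represents D s :=
  s 0 =1 load (encode_instance I) 0 /\ forall t x, s 2 (t * n + x) = ((t, x) \in D).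

Lemma represents_ext D s s' : s' 0 =1 s 0 -> s' 2 =1 s 2 ->
  represents D s -> represents D s'.
Proof. by move=> e0 e2 [h0 h2]; split=> [i|t x]; rewrite ?e0 ?e2 ?h0 ?h2. Qed.

Lemma represents_den p D s : 0 \notin writes p -> 2 \notin writes p ->
  represents D s -> represents D (den p s).
Proof. by move=> n0 n2; apply: represents_ext; apply: den_frame. Qed.

Section Eval.

Variables (D : pairs) (s : state).
Hypothesis rep : represents D s.
Variables (et ex : expr) (t : T) (x : X).
Hypotheses (Et : eval s et = t) (Ex : eval s ex = x).

Lemma eval_encourses : eval s encourses = n. Proof. by rewrite /= rep.1. Qed.
Lemma eval_entas : eval s entas = m. Proof. by rewrite /= rep.1. Qed.
Lemma eval_etable_size : eval s etable_size = m * n.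
Proof. by rewrite -{1}eval_entas -{1}eval_encourses. Qed.
Lemma eval_ebase : eval s ebase = 3 + m * n + m * n + m * n.
Proof. by rewrite -eval_etable_size. Qed.
Lemma eval_eidx : eval s (eidx et encourses ex) = t * n + x.
Proof. by rewrite -Et -Ex -eval_encourses. Qed.
Lemma eval_eidx' : eval s (eidx ex entas et) = x * m + t.
Proof. by rewrite -Et -Ex -eval_entas. Qed.
Lemma eval_ethnum_addr :
  eval s ethnum_addr = 3 + m * n + m * n + m * n + n + n * m.
Proof. by rewrite -eval_ebase -eval_entas -eval_encourses. Qed.

Lemma eval_eutil : eval s (eutil et ex) = util t x.
Proof. by rewrite -input_util -eval_eidx -rep.1. Qed.
Lemma eval_egrade_num : eval s (egrade_num et ex) = `|numq (grade t x)|%N.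
Proof. by rewrite -input_num -eval_eidx -eval_etable_size -rep.1. Qed.
Lemma eval_egrade_den : eval s (egrade_den et ex) = `|denq (grade t x)|%N.
Proof. by rewrite -input_den -eval_eidx -eval_etable_size -rep.1. Qed.
Lemma eval_ecapacity : eval s (ecapacity ex) = capacity x.
Proof. by rewrite -input_capacity -Ex -eval_ebase -rep.1. Qed.
Lemma eval_ecutil : eval s (ecutil ex et) = cutil x t.
Proof. by rewrite -input_cutil -eval_eidx' -eval_ebase -eval_encourses -rep.1. Qed.
Lemma eval_ethnum : eval s ethnum = `|numq (threshold I)|%N.
Proof. by rewrite -input_threshold_num -eval_ethnum_addr -rep.1. Qed.
Lemma eval_ethden : eval s ethden = `|denq (threshold I)|%N.
Proof. by rewrite -input_threshold_den -eval_ethnum_addr -rep.1. Qed.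
Lemma eval_edeleted : eval s (edeleted et ex) = ((t, x) \in D).
Proof. by rewrite -rep.2 -eval_eidx. Qed.

End Eval.

Lemma eval_enot0 s e : eval s (enot e) = (eval s e == 0) :> nat.
Proof. by rewrite /=; case: (eval s e). Qed.

Lemma reg_ext (r v : nat) s s' : s' r =1 s r -> eval s (reg r) = v -> eval s' (reg r) = v.
Proof. by move=> e <-; apply: e. Qed.

Lemma reg_den (r v : nat) p s :
  r \notin writes p -> eval s (reg r) = v -> eval (den p s) (reg r) = v.
Proof. by move=> rp; apply: reg_ext; apply: den_frame. Qed.

Lemma eval_candidate D s t x : represents D s -> eval s t'_ = t -> eval s x_ = x ->
  eval (den better_prog s) ecandidate = candidate D t x :> nat.
Proof.
move=> rep st sx; set s' := den _ _.
have rep' : represents D s' by apply: represents_den.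
have s't : eval s' t'_ = t by apply: reg_den.
have s'x : eval s' x_ = x by apply: reg_den.
have q : s' 9 0 = \sum_(y : X) ((util t x < util t y) && ((t, y) \notin D)).
  apply: den_sum_to => //; first by rewrite rep.1.
  move=> y s1 s1y fr; have rep1 : represents D s1 by apply: represents_ext rep; apply: fr.
  have s1t : eval s1 t'_ = t by apply: reg_ext st; apply: fr.
  have s1x : eval s1 x_ = x by apply: reg_ext sx; apply: fr.
  rewrite -[s1 8 0]/(eval s1 y_) in s1y.
  apply: eval_eand.
    by apply: eval_elt; [exact: (eval_eutil rep1 s1t s1x)|exact: (eval_eutil rep1 s1t s1y)].
  exact/eval_enot/(eval_edeleted rep1 s1t s1y).
apply: eval_eand; first exact: (eval_elt (e1 := Lit 0) (erefl 0) (eval_eutil rep' s't s'x)).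
rewrite eval_enot0 -[eval s' _]/(s' 9 0) q sum_nat_eq0; congr nat_of_bool.
by apply: eq_forallb => y; rewrite /= eqb0 negb_and negbK implybE.
Qed.

Lemma eval_rival D s t t' x :
  represents D s -> eval s t'_ = t' -> eval s x_ = x -> eval s t_ = t ->
  eval (den better_prog s) erival = (t' \in rivals D t x) :> nat.
Proof.
move=> rep st' sx st; rewrite inE.
apply: eval_eand; first exact: eval_candidate.
set s1 := den _ _; have rep1 : represents D s1 by apply: represents_den.
have s1t' : eval s1 t'_ = t' by apply: reg_den.
have s1x : eval s1 x_ = x by apply: reg_den.
have s1t : eval s1 t_ = t by apply: reg_den.
rewrite -leq_cross_rat ?grade_ge0 //; apply: eval_ele.
  by rewrite -(eval_egrade_num rep1 s1t s1x) -(eval_egrade_den rep1 s1t' s1x).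
by rewrite -(eval_egrade_num rep1 s1t' s1x) -(eval_egrade_den rep1 s1t s1x).
Qed.

Lemma eval_pointer D s t x : represents D s -> eval s t'_ = t -> eval s x_ = x ->
  eval (den better_prog s) epointer = (t \in pointers D x) :> nat.
Proof.
move=> rep st sx; rewrite inE.
apply: eval_eand; first exact: eval_candidate.
apply: eval_enot; apply: (@eval_edeleted D); first exact: represents_den.
  exact: reg_den.
exact: reg_den.
Qed.

Lemma sum_mem (A : {set T}) (F : T -> nat) :
  \sum_t (if t \in A then F t else 0) = \sum_(t in A) F t.
Proof. by rewrite [RHS]big_mkcond. Qed.

Section Accumulators.

Variables (D : pairs) (s : state) (t : T) (x : X).
Hypotheses (rep : represents D s) (sx : eval s x_ = x) (st : eval s t_ = t).

Lemma den_card : den card_prog s 10 0 = #|rivals D t x|.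
Proof.
rewrite -sum1_card -sum_mem; apply: den_sum_to => //; first by rewrite rep.1.
move=> t' s1 s1t fr; have rep1 : represents D s1 by apply: represents_ext rep; apply: fr.
have s1x : eval s1 x_ = x by apply: reg_ext sx; apply: fr.
rewrite (eval_rival (t := t) rep1 s1t s1x); last by apply: reg_ext st; apply: fr.
by case: ifP.
Qed.

Lemma den_total : den total_prog s 11 0 = \sum_(t' in rivals D t x) cutil x t'.
Proof.
rewrite -sum_mem; apply: den_sum_to => //; first by rewrite rep.1.
move=> t' s1 s1t fr; have rep1 : represents D s1 by apply: represents_ext rep; apply: fr.
have s1x : eval s1 x_ = x by apply: reg_ext sx; apply: fr.
apply: eval_eif.
  by apply: (eval_rival rep1 s1t s1x); apply: reg_ext st; apply: fr.
by apply: (@eval_ecutil D); [exact: represents_den|exact: reg_den|exact: reg_den].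
Qed.

Lemma den_conflict :
  (den conflict_prog s 12 0 != 0) = [exists t' in rivals D t x, (t', x) \in D].
Proof.
have -> : den conflict_prog s 12 0 = \sum_(t' : T) ((t' \in rivals D t x) && ((t', x) \in D)).
  apply: den_sum_to => //; first by rewrite rep.1.
  move=> t' s1 s1t fr; have rep1 : represents D s1 by apply: represents_ext rep; apply: fr.
  have s1x : eval s1 x_ = x by apply: reg_ext sx; apply: fr.
  apply: eval_eand.
    by apply: (eval_rival rep1 s1t s1x); apply: reg_ext st; apply: fr.
  by apply: (@eval_edeleted D); [exact: represents_den|exact: reg_den|exact: reg_den].
rewrite sum_nat_eq0 negb_forall; apply: eq_existsb => t'.
by rewrite eqb0 negbK.
Qed.

End Accumulators.

Lemma step_prog_spec D s t x : represents D s -> eval s x_ = x -> eval s t_ = t ->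
  represents (step D (t, x)) (den step_prog s).
Proof.
move=> rep sx st; rewrite /step_prog.
set s1 := den card_prog s; have rep1 : represents D s1 by apply: represents_den.
have s1x : eval s1 x_ = x by apply: reg_den.
have s1t : eval s1 t_ = t by apply: reg_den.
set s2 := den total_prog s1; have rep2 : represents D s2 by apply: represents_den.
have s2x : eval s2 x_ = x by apply: reg_den.
have s2t : eval s2 t_ = t by apply: reg_den.
set s3 := den conflict_prog s2; have rep3 : represents D s3 by apply: represents_den.
have s3x : eval s3 x_ = x by apply: reg_den.
have s3t : eval s3 t_ = t by apply: reg_den.
rewrite -[den _ s]/(if eval s3 edeletable != 0 then
  update s3 2 (eval s3 (eidx t_ encourses x_)) 1 else s3).
have -> : (eval s3 edeletable != 0) = deletable D t x.
  have -> : eval s3 edeletable = s3 12 0 + ((capacity x < #|rivals D t x|)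
      + ((#|rivals D t x| == capacity x) && ~~ satisfies x (rivals D t x))).
    (* The accumulators 10 and 11 survive the later programs, which accumulate elsewhere. *)
    have c10 : eval s3 (reg 10) = #|rivals D t x|.
      by do 2 apply: reg_den => //; apply: den_card.
    have c11 : eval s3 (reg 11) = \sum_(t' in rivals D t x) cutil x t'.
      by apply: reg_den => //; apply: den_total.
    rewrite -[LHS]/(s3 12 0 + (eval s3 eoverfull + eval s3 eunsatisfied)).
    congr (_ + (_ + _)); first exact: (eval_elt (eval_ecapacity rep3 s3x) c10).
    apply: (eval_eand (eval_eeq c10 (eval_ecapacity rep3 s3x))).
    rewrite /satisfies -ltnNge; apply: eval_elt.
      by rewrite -(eval_ethden rep3) -c11.
    by rewrite -(eval_ethnum rep3) -(eval_ecapacity rep3 s3x).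
  rewrite !addn_eq0 !negb_and (den_conflict rep2 s2x s2t) !eqb0 !negbK.
  by [].
rewrite (eval_eidx rep3 s3t s3x) /step /=; case: ifP => _ //.
split=> [i|t' x']; first exact: rep3.1.
rewrite /update eqxx /=.
rewrite in_setU1 xpair_eqE; have [/row_inj[-> ->]|ne] := eqVneq; first by rewrite !eqxx.
rewrite rep3.2; case: eqP => //= e1; case: eqP => //= e2.
by rewrite e1 e2 eqxx in ne.
Qed.

(** * Sweeps over all pairs *)

Lemma eval_update_other s (r r' j v : nat) :
  r != r' -> eval s (reg r) = v -> eval (update s r' 0 j) (reg r) = v.
Proof. by move=> /negPf ne; rewrite /= /update ne. Qed.

Lemma represents_update D s (r i j : nat) : r != 0 -> r != 2 ->
  represents D s -> represents D (update s r i j).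
Proof.
by move=> r0 r2; apply: represents_ext => b; rewrite /update eq_sym ?(negPf r0) ?(negPf r2).
Qed.

(** The invariant of a sweep that starts with [D0] and has visited the pairs in [done]. A stationary
    [D0] does not change; as long as nothing has changed, no visited pair refutes stationarity. So a
    complete sweep without change shows that [D0] is stationary. *)
Definition progress D0 (done : T -> X -> bool) s := exists D,
  [/\ represents D s, sound D, D0 \subset D, stationary D0 -> D = D0
    & D = D0 -> forall t x, done t x -> deletable D0 t x -> (t, x) \in D0].

Lemma progress_ext D0 (done done' : T -> X -> bool) s s' :
  (forall D, represents D s -> represents D s') -> (forall t x, done' t x -> done t x) ->
  progress D0 done s -> progress D0 done' s'.
Proof.
move=> hr hd [D [rep sD sub st dn]]; exists D; split=> //; first exact: hr.
by move=> /dn h t x /hd; apply: h.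
Qed.

Lemma progress_step D0 (done : T -> X -> bool) s t x :
  eval s x_ = x -> eval s t_ = t -> progress D0 done s ->
  progress D0 (fun t' x' => done t' x' || ((t', x') == (t, x))) (den step_prog s).
Proof.
move=> sx st [D [rep sD sub statD dn]]; exists (step D (t, x)).
have sub' : D \subset step D (t, x) by rewrite /step; case: ifP => // _; apply: subsetU1.
split.
- exact: step_prog_spec.
- exact: sound_step.
- exact: subset_trans sub sub'.
- move=> stat0; have := statD stat0 => ->; rewrite /step /=; case: ifP => // /stat0 xin.
  by apply/setUidPr; rewrite sub1set.
(* Sets only grow, so if this step ends in [D0], nothing had changed before it either. *)
move=> eD; have eD' : D = D0 by apply/eqP; rewrite eqEsubset sub andbT -eD.
move=> t' x' /orP[|/eqP[-> ->]]; first exact: dn.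
by move=> del; rewrite -eD eD' /step /= del setU11.
Qed.

Lemma round_prog_spec D0 s : represents D0 s -> sound D0 ->
  progress D0 (fun _ _ => true) (den round_prog s).
Proof.
move=> rep sD.
apply: (@progress_ext _ (fun t x => x < n) _ (den round_prog s)) => //.
apply: (@den_forP n (fun l => progress D0 (fun t x => x < l))) => //.
- by rewrite rep.1.
- by exists D0; split=> //; apply: represents_update.
move=> x s1 s10 s1x hI; rewrite -[s1 3 0]/(eval s1 x_) in s1x.
apply: (@progress_ext _ (fun t' x' => (x' < x) || ((x' == x) && (t' < m))) _
  (den (PFor 4 2 step_prog) s1)).
- by move=> D; apply: represents_update.
- by move=> t' x'; rewrite ltnS leq_eqVlt ltn_ord andbT orbC.
pose Inv (l : nat) s' := eval s' x_ = x /\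
  progress D0 (fun t' x' => (x' < x) || ((x' == x) && (t' < l))) s'.
suff [] : Inv m (den (PFor 4 2 step_prog) s1) by [].
apply: den_forP => //.
- by rewrite s10 rep.1.
- split; first exact: eval_update_other.
  apply: progress_ext hI => [D|t' x']; first exact: represents_update.
  by rewrite andbF orbF.
- move=> t s2 _ s2t [s2x h2]; rewrite -[s2 4 0]/(eval s2 t_) in s2t.
  split; first by apply: eval_update_other => //; apply: reg_den.
  apply: progress_ext (progress_step s2x s2t h2) => [D|t' x']; first exact: represents_update.
  case/orP => [-> //|/andP[/eqP -> lt]]; rewrite eqxx ltnn /= xpair_eqE eqxx andbT.
  by rewrite orbC -leq_eqVlt.
Qed.

(** After [l] sweeps the set is stationary or has at least [l] elements. After [n * m] sweeps the
    second case leaves no pair outside the set, which is then stationary too. *)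
Lemma rounds_prog_spec s : represents set0 s ->
  exists D, [/\ represents D (den rounds_prog s), sound D & stationary D].
Proof.
move=> rep0; pose Inv (l : nat) s' := exists D,
  [/\ represents D s', sound D & stationary D \/ l <= #|D|].
suff [D [rep sD [//|full]]] : Inv (n * m) (den rounds_prog s); first by exists D.
  exists D; split=> // t x _; suff -> : D = setT by rewrite inE.
  by apply/eqP; rewrite eqEcard subsetT cardsT card_prod !card_ord mulnC.
apply: (@den_forP n (fun l => Inv (l * m))) => //.
- by rewrite rep0.1.
- exists set0; split; [exact: represents_update| |by right].
  by move=> mu t x _ _; rewrite inE.
move=> a s1 s10 _ h1.
suff [D [rep h1' h2']] : Inv (a.+1 * m) (den (PFor 6 2 round_prog) s1).
  by exists D; split=> //; apply: represents_update.
rewrite mulSnr; apply: (@den_forP m (fun l => Inv (a * m + l))) => //.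
- by rewrite s10 rep0.1.
- by have [D [rep h1' h2']] := h1; exists D; split; [exact: represents_update| |rewrite addn0].
move=> b s2 _ _ [D0 [rep0' sD0 h2]].
have [D [rep sD sub st dn]] := round_prog_spec rep0' sD0.
exists D; split=> //.
have [eD|neD] := eqVneq D D0.
  by left; rewrite eD => t x; apply: dn.
(* The sweep changed the set, so it was not stationary before; it had enough elements and has gained
   one. *)
right; case: h2 => [/st eD|le]; first by rewrite eD eqxx in neD.
rewrite addnS (leq_ltn_trans le) // proper_card // properEneq eq_sym neD; exact: sub.
Qed.

(** * Final test and output *)

Lemma fail_prog_spec D s : represents D s ->
  (den fail_prog s 13 0 == 0) = [forall x, #|pointers D x| == capacity x].
Proof.
move=> rep.
have -> : den fail_prog s 13 0 = \sum_(x : X) (#|pointers D x| != capacity x).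
  apply: den_sum_to => //; first by rewrite rep.1.
  move=> x s1 s1x fr; have rep1 : represents D s1 by apply: represents_ext rep; apply: fr.
  rewrite -[s1 3 0]/(eval s1 x_) in s1x.
  apply: eval_enot; apply: eval_eeq; last first.
    by apply: (@eval_ecapacity D); [exact: represents_den|exact: reg_den].
  rewrite -sum1_card -sum_mem; apply: den_sum_to => //; first by rewrite rep1.1.
  move=> t s2 s2t fr2; have rep2 : represents D s2 by apply: represents_ext rep1; apply: fr2.
  have s2x : eval s2 x_ = x by apply: reg_ext s1x; apply: fr2.
  by rewrite (eval_pointer rep2 s2t s2x); case: ifP.
by rewrite sum_nat_eq0; apply: eq_forallb => x /=; rewrite eqb0 negbK.
Qed.

(** What the output cell of [t] holds once the pairs in [done] have been visited. *)
Definition answer_cell D (done : T -> X -> bool) t : nat :=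
  if pointer_matching D t is Some x then if done t x then x.+1 else 0 else 0.

Definition answers D (done : T -> X -> bool) s :=
  [/\ represents D s, s 1 0 = m.+1, s 1 1 = 1
    & forall t, s 1 (t + 2) = answer_cell D done t].

Lemma answers_ext D (done done' : T -> X -> bool) s s' :
  s' 0 =1 s 0 -> s' 1 =1 s 1 -> s' 2 =1 s 2 -> done =2 done' ->
  answers D done s -> answers D done' s'.
Proof.
move=> e0 e1 e2 ed [rep h0 h1 ha]; split; rewrite ?e1 //; first exact: represents_ext rep.
move=> t; rewrite e1 ha /answer_cell.
by case: (pointer_matching D t) => // x; rewrite ed.
Qed.

Lemma answers_update D (done done' : T -> X -> bool) s (r j : nat) :
  r \notin [:: 0; 1; 2] -> done =2 done' ->
  answers D done s -> answers D done' (update s r 0 j).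
Proof.
rewrite !inE !negb_or => /and3P[r0 r1 r2].
by apply: answers_ext => i; rewrite /update eq_sym ?(negPf r0) ?(negPf r1) ?(negPf r2).
Qed.

Lemma answers_step D (done : T -> X -> bool) s t x :
  eval s x_ = x -> eval s t'_ = t -> answers D done s ->
  answers D (fun t' x' => done t' x' || ((t', x') == (t, x)))
    (den (PSeq better_prog
      (PIf epointer (PWrite 1 (eadd t'_ (Lit 2)) (eadd x_ (Lit 1))) PSkip)) s).
Proof.
move=> sx st [rep h0 h1 ha].
set s1 := den better_prog s; have rep1 : represents D s1 by apply: represents_den.
have s1x : eval s1 x_ = x by apply: reg_den.
have s1t : eval s1 t'_ = t by apply: reg_den.
have s11 : s1 1 =1 s 1 by apply: den_frame.
rewrite -[den _ s]/(if eval s1 epointer != 0 then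
  update s1 1 (eval s1 t'_ + 2) (eval s1 x_ + 1) else s1) s1x s1t.
rewrite (eval_pointer rep st sx) eqb0 negbK; case: ifP => ptr.
  split; rewrite ?/update /= ?addn2 //= ?s11 //.
  move=> t'; rewrite !addn2 s11 !eqSS; case: eqVneq => [/val_inj ->|ne].
    move: ptr; rewrite -(pointer_matchingP Hdv) /answer_cell => /eqP ->.
    by rewrite eqxx orbT addn1.
  rewrite -addn2 ha /answer_cell; case: (pointer_matching D t') => // x'.
  by rewrite xpair_eqE (_ : (t' == t) = false) ?orbF //; apply/eqP => e; rewrite e eqxx in ne.
split; rewrite ?s11 // => t'; rewrite s11 ha /answer_cell.
(* Here [t] does not point to [x], so having visited this pair affects no entry. *)
case E: (pointer_matching D t') => [x'|] //.
case: (eqVneq (t', x') (t, x)) => [[e1 e2]|_]; last by rewrite orbF.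
by move/eqP: E; rewrite (pointer_matchingP Hdv) e1 e2 ptr.
Qed.

Lemma assign_prog_spec D s : answers D (fun _ _ => false) s ->
  answers D (fun _ _ => true) (den assign_prog s).
Proof.
move=> ans; have [rep _ _ _] := ans.
apply: (@answers_ext _ (fun t x => x < n) _ (den assign_prog s)) => //.
  by move=> t x; rewrite ltn_ord.
apply: (@den_forP n (fun l => answers D (fun t x => x < l))) => //.
- by rewrite rep.1.
move=> x s1 s10 s1x hI; rewrite -[s1 3 0]/(eval s1 x_) in s1x.
set body := PSeq _ _.
apply: (@answers_update _ (fun t' x' => (x' < x) || ((x' == x) && (t' < m))) _
  (den (PFor 7 2 body) s1)) => //.
  by move=> t' x'; rewrite /= ltn_ord andbT ltnS [in RHS]leq_eqVlt orbC -val_eqE.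
pose Inv (l : nat) s' := eval s' x_ = x /\
  answers D (fun t' x' => (x' < x) || ((x' == x) && (t' < l))) s'.
suff [] : Inv m (den (PFor 7 2 body) s1) by [].
apply: den_forP => //.
- by rewrite s10 rep.1.
- split; first exact: eval_update_other.
  by apply: answers_update hI => // t' x'; rewrite andbF orbF.
- move=> t s2 _ s2t [s2x h2]; rewrite -[s2 7 0]/(eval s2 t'_) in s2t.
  split; first by apply: eval_update_other => //; apply: reg_den.
  apply: answers_update (answers_step s2x s2t h2) => // t' x'.
  rewrite xpair_eqE ltnS [(t' <= t)%N]leq_eqVlt -!val_eqE /= -orbA [X in _ || (_ || X)]andbC.
  by rewrite -andb_orr (orbC (t' < t)).
Qed.

Lemma output_answers D s : answers D (fun _ _ => true) s ->
  output s = encode_answer (Some (pointer_matching D)).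
Proof.
case=> _ h0 h1 ha; rewrite /output h0 /mkseq /= h1; congr cons.
rewrite (iotaDl 1 0) -map_comp -val_enum_ord -map_comp; apply: eq_map => t /=.
by rewrite add1n -addn2 ha.
Qed.

Lemma main_prog_spec : exists2 ans : option (matching I),
  output (den main_prog (load (encode_instance I))) = encode_answer ans
  & correct_answer ans.
Proof.
set s := load _; set s1 := den fail_prog (den rounds_prog s).
rewrite -[den _ s]/(if s1 13 0 != 0 then update s1 1 0 1
  else den assign_prog (den header_prog s1)).
have rep0 : represents set0 s by split=> // t x; rewrite inE.
have [D [rep1 sD statD]] := rounds_prog_spec rep0.
have s11 : s1 1 =1 s 1 by move=> i; rewrite /s1 !den_frame.
have rep : represents D s1 by apply: represents_den.
rewrite (fail_prog_spec rep1); case: ifPn => full.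
  (* Only the length 1 has been written; the report itself is the initial 0 of cell 1. *)
  exists None => [|[mu mmu]]; first by rewrite /output /update /= /mkseq /= s11.
  case/negP: full; apply/forallP => x; apply/eqP.
  exact: (mefe_pointers_full statD x sD mmu).
exists (Some (pointer_matching D)).
  apply/output_answers/assign_prog_spec; split=> // [|t].
    by rewrite /update /= rep.1 input_ntas addn1.
  rewrite addn2 /= /update /= s11 /answer_cell.
  by case: (pointer_matching D t).
apply: (mefe_pointer_matching Hdv statD) => x.
by move: full; rewrite negbK => /forallP/(_ x)/eqP.
Qed.

(** Without courses the matching that assigns nobody is MEFE, as all conditions on courses are
    vacuous. *)
Lemma header_prog_spec : n = 0 -> exists2 ans : option (matching I),
  output (den header_prog (load (encode_instance I))) = encode_answer ans
  & correct_answer ans.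
Proof.
move=> n0; have noX (x : X) : False by have := ltn_ord x; rewrite [X in _ < X]n0.
exists (Some (pointer_matching set0)).
  apply: output_answers; split=> // [|t].
    by rewrite /update /= addn1.
  rewrite addn2 /= /update /= /answer_cell.
  by case: (pointer_matching set0 t).
by apply: (mefe_pointer_matching Hdv) => [t x|x]; case: (noX x).
Qed.

End Program.

(** Without courses the input has length logarithmic in the number of TAs, so
    there is no time to visit them; the cells of the answer are already 0. *)
Definition mefe_prog := PIf encourses main_prog header_prog.

Lemma den_mefe_prog s :
  den mefe_prog s = if s 0 1 != 0 then den main_prog s else den header_prog s.
Proof. by []. Qed.

Lemma mefe_prog_spec (I : mefe_instance) : distinct_valuations I ->
  exists2 ans : option (matching I),
    output (den mefe_prog (load (encode_instance I))) = encode_answer ans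
    & correct_answer ans.
Proof.
move=> Hdv; rewrite den_mefe_prog.
case: ifPn => [_|]; first exact: main_prog_spec.
by rewrite negbK => /eqP; apply: header_prog_spec.
Qed.

(** If there is a course, the tables have at least one entry per TA, so the input size bounds both
    loop bounds. Otherwise only [header_prog] runs, which has no loops. *)
Lemma exec_mefe_prog (I : mefe_instance) :
  let N := input_size (encode_instance I) in
  exists2 t, exec (compile mefe_prog) (load (encode_instance I)) t
    (den mefe_prog (load (encode_instance I))) & t <= time N mefe_prog N.
Proof.
set s := load _; move=> N; have f : fits N s by apply: fits_load.
have le : 4 + 3 * (ntas I * ncourses I) + ncourses I <= N.
  apply: leq_trans (size_le_input_size _); rewrite size_encode_instance; lia.
have [n0|n_gt0] := eqVneq (ncourses I) 0; last first.
  have [k kb|t [x l _]] := @exec_compile N mefe_prog N s isT _ f; last by exists t.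
  have {kb} : k \in [:: 1; 2] by move: k kb; apply/allP.
  rewrite !inE => /orP[]/eqP ->; first by rewrite (input_ncourses I : s 0 1 = _); lia.
  by rewrite (input_ntas I : s 0 2 = _); move: n_gt0; nia.
have [//|t [x l _]] := @exec_compile N header_prog N s isT _ f.
have s01 : s 0 1 = 0 by exact: n0.
rewrite den_mefe_prog s01 eqxx.
eexists; first by apply: exec_IfFalse x.
by apply: leq_add (step_cost_le encourses f) _; apply: leq_trans l (leq_addl _ _).
Qed.

Theorem theorem8 :
  @polytime_solvable mefe_instance (fun I => option (matching I))
    encode_instance encode_answer
    (fun I => two_positive_valuations I /\ distinct_grades I
              /\ distinct_valuations I)
    correct_answer.
Proof.
have [p timep] := polybounded_time mefe_prog polybounded_id.
exists (compile mefe_prog), p => I [_ [_ Hdv]].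
have [t x l] := exec_mefe_prog I.
exists t, (den mefe_prog (load (encode_instance I))); split=> //.
  exact: leq_trans l (timep _).
exact: mefe_prog_spec.
Qed.
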